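(* Each of the groups $P_1,P_2,P_3$ maps the set of ten MUB lines in $\mathbb{H}^2$ to itself. The kernel of the resulting action of $P_3$ on the ten MUB lines is $\langle -I\rangle=\{I,-I\}$. Moreover $P_3$ permutes the five MUB pairs, and the kernel of the action of $P_3$ on the five MUB pairs is the group $K$.
   Context: $\mathbb{H}$ denotes the quaternions and $Q_8=\{\pm1,\pm i,\pm j,\pm k\}$. $\mathbb{H}^2$ is a right $\mathbb{H}$-module, with matrices acting on the left. A line is a subspace $v\mathbb{H}$ with $v\neq0$, and a matrix group acts on lines by $g\cdot(v\mathbb{H})=(gv)\mathbb{H}$. The five MUB pairs are the following five orthonormal bases of $\mathbb{H}^2$, each regarded as an unordered pair of lines; the ten MUB lines are the lines spanned by their vectors: $$\left\{\begin{pmatrix}1\\0\end{pmatrix},\begin{pmatrix}0\\1\end{pmatrix}\right\},\quad \left\{\tfrac1{\sqrt2}\begin{pmatrix}1\\\pm1\end{pmatrix}\right\},\quad \left\{\tfrac1{\sqrt2}\begin{pmatrix}1\\\pm i\end{pmatrix}\right\},\quad \left\{\tfrac1{\sqrt2}\begin{pmatrix}1\\\pm j\end{pmatrix}\right\},\quad \left\{\tfrac1{\sqrt2}\begin{pmatrix}1\\\pm k\end{pmatrix}\right\}.$$ The groups are $$P_1=\left\langle \begin{pmatrix}i&0\\0&1\end{pmatrix},\ \tfrac12\begin{pmatrix}1+j&-1+j\\-1+j&1+j\end{pmatrix}\right\rangle,\qquad P_2=\left\langle \begin{pmatrix}i&0\\0&1\end{pmatrix},\ \begin{pmatrix}j&0\\0&1\end{pmatrix},\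 \tfrac12\begin{pmatrix}1+j&-1+j\\-1+j&1+j\end{pmatrix}\right\rangle,$$ $$P_3=\left\langle \begin{pmatrix}i&0\\0&1\end{pmatrix},\ \begin{pmatrix}j&0\\0&1\end{pmatrix},\ \tfrac1{\sqrt2}\begin{pmatrix}1&1\\1&-1\end{pmatrix}\right\rangle,$$ of orders $320$, $1920$, $3840$ respectively, and $K$ is the group of order $32$ $$K=\left\langle \begin{pmatrix}0&1\\1&0\end{pmatrix},\begin{pmatrix}0&i\\-i&0\end{pmatrix},\begin{pmatrix}0&j\\-j&0\end{pmatrix},\begin{pmatrix}0&k\\-k&0\end{pmatrix}\right\rangle,$$ whose elements are $\begin{pmatrix}q&0\\0&\pm q\end{pmatrix}$, $\begin{pmatrix}0&q\\\pm q&0\end{pmatrix}$, $q\in Q_8$. *)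

(* Defs.v *)
From HB Require Import structures.
From mathcomp Require Import all_boot all_order all_algebra ring.
From mathcomp Require Import boolp classical_sets functions reals.

Set Implicit Arguments.
Unset Strict Implicit.
Unset Printing Implicit Defensive.

Import Order.TTheory GRing.Theory Num.Theory.
Local Open Scope classical_set_scope.
Local Open Scope ring_scope.

(* Quat a b c d is the quaternion a + b i + c j + d k. *)
Record quat (R : Type) := Quat { qre : R; qim : R; qjm : R; qkm : R }.

Lemma quat_eqP (R : Type) (x y : quat R) :
  qre x = qre y -> qim x = qim y -> qjm x = qjm y -> qkm x = qkm y -> x = y.
Proof. by case: x y => [? ? ? ?] [? ? ? ?] /= -> -> -> ->. Qed.

Definition prod_of_quat (R : Type) (x : quat R) : R * R * R * R :=
  (qre x, qim x, qjm x, qkm x).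
Definition quat_of_prod (R : Type) (p : R * R * R * R) : quat R :=
  Quat p.1.1.1 p.1.1.2 p.1.2 p.2.
Lemma prod_of_quatK (R : Type) : cancel (@prod_of_quat R) (@quat_of_prod R).
Proof. by case. Qed.

HB.instance Definition _ (R : choiceType) :=
  Choice.copy (quat R) (can_type (@prod_of_quatK R)).

Section QuatRing.
Variable R : comNzRingType.
Implicit Types x y : quat R.

Definition addq x y :=
  Quat (qre x + qre y) (qim x + qim y) (qjm x + qjm y) (qkm x + qkm y).
Definition oppq x := Quat (- qre x) (- qim x) (- qjm x) (- qkm x).

Definition mulq x y := Quat
  (qre x * qre y - qim x * qim y - qjm x * qjm y - qkm x * qkm y)
  (qre x * qim y + qim x * qre y + qjm x * qkm y - qkm x * qjm y)
  (qre x * qjm y - qim x * qkm y + qjm x * qre y + qkm x * qim y)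
  (qre x * qkm y + qim x * qjm y - qjm x * qim y + qkm x * qre y).

Lemma addqA : associative addq.
Proof. by move=> x y z; apply: quat_eqP; rewrite /= addrA. Qed.
Lemma addqC : commutative addq.
Proof. by move=> x y; apply: quat_eqP; rewrite /= addrC. Qed.
Lemma add0q : left_id (Quat 0 0 0 0) addq.
Proof. by move=> x; apply: quat_eqP; rewrite /= add0r. Qed.
Lemma addNq : left_inverse (Quat 0 0 0 0) oppq addq.
Proof. by move=> x; apply: quat_eqP; rewrite /= addNr. Qed.

HB.instance Definition _ :=
  GRing.isZmodule.Build (quat R) addqA addqC add0q addNq.

Lemma mulqA : associative mulq.
Proof. by move=> x y z; apply: quat_eqP => /=; ring. Qed.
Lemma mul1q : left_id (Quat 1 0 0 0) mulq.
Proof. by move=> x; apply: quat_eqP => /=; ring. Qed.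
Lemma mulq1 : right_id (Quat 1 0 0 0) mulq.
Proof. by move=> x; apply: quat_eqP => /=; ring. Qed.
Lemma mulqDl : left_distributive mulq addq.
Proof. by move=> x y z; apply: quat_eqP => /=; ring. Qed.
Lemma mulqDr : right_distributive mulq addq.
Proof. by move=> x y z; apply: quat_eqP => /=; ring. Qed.
Lemma oneq_neq0 : Quat 1 0 0 0 != 0 :> quat R.
Proof. by apply/eqP => -[] /eqP; rewrite oner_eq0. Qed.

HB.instance Definition _ := GRing.Zmodule_isNzRing.Build (quat R)
  mulqA mul1q mulq1 mulqDl mulqDr oneq_neq0.

End QuatRing.

Definition qreal (R : nzRingType) (r : R) : quat R := Quat r 0 0 0.
Definition qi (R : nzRingType) : quat R := Quat 0 1 0 0.
Definition qj (R : nzRingType) : quat R := Quat 0 0 1 0.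
Definition qk (R : nzRingType) : quat R := Quat 0 0 0 1.
Arguments qi {R}.
Arguments qj {R}.
Arguments qk {R}.

Lemma quat_relations (R : comNzRingType) :
  [/\ qi * qi = -1 :> quat R, qj * qj = -1 :> quat R, qk * qk = -1 :> quat R
    & qi * qj * qk = -1 :> quat R].
Proof. by split; apply: quat_eqP => /=; ring. Qed.

(* Subgroups of the unit group of a ring, as sets of ring elements. *)
Definition unit_subgroup (A : nzRingType) (G : set A) : Prop :=
  [/\ G 1, (forall g h, G g -> G h -> G (g * h))
    & forall g, G g -> exists2 h, G h & g * h = 1 /\ h * g = 1].

(* When the elements of S are invertible, this is the subgroup they generate;
   when some element of S is not, no unit_subgroup contains S. *)
Definition gen_group (A : nzRingType) (S : set A) : set A :=
  smallest (@unit_subgroup A) S.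

Lemma gen_group_subgroup (A : nzRingType) (S : set A) :
  (forall s, S s -> exists t, s * t = 1 /\ t * s = 1) ->
  unit_subgroup (gen_group S).
Proof.
move=> Sinv.
have UG : unit_subgroup [set g : A | exists t, g * t = 1 /\ t * g = 1].
  split=> /=; first by exists 1; rewrite mulr1.
    move=> g h [g' [gg' g'g]] [h' [hh' h'h]]; exists (h' * g'); split.
      by rewrite mulrA -(mulrA g) hh' mulr1.
    by rewrite mulrA -(mulrA h') g'g mulr1.
  by move=> g [h [gh hg]]; exists h => //; exists g.
split.
- by move=> G /= [[]].
- move=> g h Gg Gh G /= GS; have [[_ GM _] _] := GS.
  by apply: GM; [apply: Gg | apply: Gh].
- move=> g Gg; have [h [gh hg]] := Gg _ (conj UG Sinv); exists h => //.
  move=> G /= GS; have [[_ _ GV] _] := GS.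
  have [h' Gh' [gh' _]] := GV _ (Gg _ GS).
  by rewrite -[h]mulr1 -gh' mulrA hg mul1r.
Qed.

Section QuatPlane.
Variable R : realType.
Local Notation H := (quat R).
Implicit Types (a b c d u : H) (v : 'cV[H]_2) (g : 'M[H]_2).

Definition vec2 a b : 'cV[H]_2 := \col_(r < 2) if r == 0 then a else b.

Definition mat2 a b c d : 'M[H]_2 := \matrix_(r < 2, s < 2)
  if r == 0 then (if s == 0 then a else b) else (if s == 0 then c else d).

(* v h for the right H-module structure ( *: would multiply on the left). *)
Definition rscale v (h : H) : 'cV[H]_2 := map_mx (fun x => x * h) v.

Definition line v : set 'cV[H]_2 := range (rscale v).

Definition act_line g (L : set 'cV[H]_2) : set 'cV[H]_2 := mulmx g @` L.

Definition act_pair g (p : set (set 'cV[H]_2)) : set (set 'cV[H]_2) :=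
  act_line g @` p.

Lemma act_line_line g v : act_line g (line v) = line (g *m v).
Proof.
have rM h : g *m rscale v h = rscale (g *m v) h.
  apply/matrixP => r s; rewrite !mxE mulr_suml.
  by apply: eq_bigr => t _; rewrite !mxE mulrA.
apply/seteqP; split=> w /=.
  by case=> _ [h _ <-] <-; exists h.
by case=> h _ <-; exists (rscale v h); rewrite ?rM //; exists h.
Qed.

Definition act_kernel (T : Type) (act : 'M[H]_2 -> T -> T)
    (G : set 'M[H]_2) (X : set T) : set 'M[H]_2 :=
  [set g | G g /\ forall x, X x -> act g x = x].

(* Real scalars are central, so scaling by them with *: is unambiguous. *)
Definition qhalf : H := qreal 2^-1.
Definition isqrt2 : H := qreal (Num.sqrt 2)^-1.

Definition std_pair : set (set 'cV[H]_2) :=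
  [set line (vec2 1 0); line (vec2 0 1)].
Definition pm_pair u : set (set 'cV[H]_2) :=
  [set line (isqrt2 *: vec2 1 u); line (isqrt2 *: vec2 1 (- u))].

Definition MUB_pairs : set (set (set 'cV[H]_2)) :=
  [set std_pair; pm_pair 1; pm_pair qi; pm_pair qj; pm_pair qk].
Definition MUB_lines : set (set 'cV[H]_2) := \bigcup_(p in MUB_pairs) p.

Definition diag_i : 'M[H]_2 := mat2 qi 0 0 1.
Definition diag_j : 'M[H]_2 := mat2 qj 0 0 1.
Definition mat_j : 'M[H]_2 :=
  qhalf *: mat2 (1 + qj) (- 1 + qj) (- 1 + qj) (1 + qj).
Definition hadamard : 'M[H]_2 := isqrt2 *: mat2 1 1 1 (- 1).

Definition P1 : set 'M[H]_2 := gen_group [set diag_i; mat_j].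
Definition P2 : set 'M[H]_2 := gen_group [set diag_i; diag_j; mat_j].
Definition P3 : set 'M[H]_2 := gen_group [set diag_i; diag_j; hadamard].

Definition K : set 'M[H]_2 :=
  gen_group [set mat2 0 1 1 0; mat2 0 qi (- qi) 0;
                 mat2 0 qj (- qj) 0; mat2 0 qk (- qk) 0].

End QuatPlane.

Arguments MUB_pairs : clear implicits.
Arguments MUB_lines : clear implicits.
Arguments P1 : clear implicits.
Arguments P2 : clear implicits.
Arguments P3 : clear implicits.
Arguments K : clear implicits.

(* Main.v *)
Require Import Defs.
From HB Require Import structures.
From mathcomp Require Import all_boot all_order all_algebra.
From mathcomp Require Import boolp classical_sets functions reals.
From mathcomp Require Import ring lra.

Import Order.TTheory GRing.Theory Num.Theory.
Local Open Scope classical_set_scope.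
Local Open Scope ring_scope.

(** The line spanned by (a, b) with a invertible is the line of (1, b a^-1), so
    a matrix acts on the lines (1, u) H by a formula on the slope u.  In these
    terms diag(q, 1) sends the slope u to u q^-1 and fixes the standard pair,
    while the Hadamard matrix swaps the standard pair with the pair of slopes
    1, -1 and sends every u with u^2 = -1 to -u.  The generators of [P3]
    therefore permute the five pairs.  They are also invertible isometries, and
    these three properties define a group ([MUB_symmetry_subgroup]), which
    contains all of [P3].  The matrix [mat_j] is the conjugate of [diag_j] by
    the Hadamard matrix ([hadamard_conj_diag]), so [P1] and [P2] lie in [P3].

    A matrix that fixes both standard lines is diagonal, diag(a, d); it fixes
    the line of slope u exactly when d u = u a.  The slope 1 gives d = a, the
    slopes i and j make a commute with i and j, so a is real, and a = 1 or
    a = -1 because a has norm 1 ([kernel_lines]).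

    For the pairs the same equations hold up to sign: d = a or d = -a, and a
    commutes or anticommutes with i and with j.  Each of the four sign patterns
    leaves a single nonzero coordinate of a, so the norm puts a in Q_8
    ([unit_pm_commute_Q8]) and the matrix in [K] ([kernel_diag_in_K]).  An
    antidiagonal matrix of the kernel is reduced to this case by multiplying it
    with the coordinate swap, which belongs to [K]. *)

(** * Generated groups and finite sets *)

Lemma gen_group_min (A : nzRingType) (S G : set A) :
  unit_subgroup G -> S `<=` G -> gen_group S `<=` G.
Proof. by move=> UG SG; apply: smallest_sub. Qed.

Lemma sub_gen_group (A : nzRingType) (S : set A) : S `<=` gen_group S.
Proof. exact: sub_gen_smallest. Qed.

Lemma gen_groupM (A : nzRingType) (S : set A) (g h : A) :
  gen_group S g -> gen_group S h -> gen_group S (g * h).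
Proof.
move=> Gg Gh G /= GS; have [[_ GM _] _] := GS.
by apply: GM; [apply: Gg | apply: Gh].
Qed.

Lemma gen_group_mono (A : nzRingType) (S T : set A) :
  (forall t, T t -> exists u, t * u = 1 /\ u * t = 1) ->
  S `<=` gen_group T -> gen_group S `<=` gen_group T.
Proof. by move=> Tinv; apply: gen_group_min; exact: gen_group_subgroup. Qed.

Lemma gen_groupN1 (A : nzRingType) : gen_group [set - 1] = [set 1; - 1] :> set A.
Proof.
apply/seteqP; split.
  apply: gen_group_min => [|_ ->]; last by right.
  split=> /=; first by left.
    by move=> g h [->|->] [->|->]; rewrite ?mul1r ?mulN1r ?opprK; [left|right|right|left].
  by move=> g [->|->]; [exists 1|exists (-1)]; rewrite ?mul1r ?mulN1r ?opprK //=; [left|right].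
have GN : gen_group [set - 1] (- 1 : A) by apply: sub_gen_group.
by move=> _ [->|-> //]; have := gen_groupM _ _ _ _ GN GN; rewrite mulrNN mulr1.
Qed.

(** Distinctness of z and w excludes that both x and y equal the same one. *)
Lemma set2_eq (T : Type) (x y z w : T) : z <> w ->
  [set x; y] = [set z; w] -> (x = z /\ y = w) \/ (x = w /\ y = z).
Proof.
move=> zw E; have /= : [set z; w] x by rewrite -E; left.
have /= : [set x; y] z by rewrite E; left.
have /= : [set x; y] w by rewrite E; right.
move=> wxy zxy [xz|xw].
  by left; split=> //; case: wxy => // wx; case: zw; rewrite wx.
by right; split=> //; case: zxy => // zx; case: zw; rewrite zx.
Qed.

Lemma image_set5 (T U : Type) (f : T -> U) (x y z t w : T) :
  f @` [set x; y; z; t; w] = [set f x; f y; f z; f t; f w].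
Proof. by rewrite !image_setU !image_set1. Qed.

(* The order of the five points follows the definition of the MUB pairs:
   standard pair, then the slopes 1, i, j, k. *)
Section FivePoints.
Variables (T : Type) (x y z t w : T).

Lemma set5_perm2345 : [set x; z; y; w; t] = [set x; y; z; t; w].
Proof. by apply/seteqP; split=> s /=; tauto. Qed.

Lemma set5_perm2435 : [set x; t; w; y; z] = [set x; y; z; t; w].
Proof. by apply/seteqP; split=> s /=; tauto. Qed.

Lemma set5_perm12 : [set y; x; z; t; w] = [set x; y; z; t; w].
Proof. by apply/seteqP; split=> s /=; tauto. Qed.

End FivePoints.

Section QuatPlane.
Variable R : realType.
Local Notation H := (quat R).
Implicit Types (a b c d u : H) (v : 'cV[H]_2) (g h : 'M[H]_2).

(** * Two by two matrices and lines *)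

Lemma mat2E g : g = mat2 (g 0 0) (g 0 1) (g 1 0) (g 1 1).
Proof.
apply/matrixP=> r s; rewrite mxE.
by case: r => -[|[|//]] ?; case: s => -[|[|//]] ? /=; congr (g _ _); apply: val_inj.
Qed.

Lemma mat2_1 : 1 = mat2 1 0 0 1 :> 'M[H]_2.
Proof. by rewrite [LHS]mat2E !mxE. Qed.

Lemma mat2_N1 : - 1 = mat2 (- 1) 0 0 (- 1) :> 'M[H]_2.
Proof. by rewrite [LHS]mat2E !mxE /= oppr0. Qed.

Lemma mat2M a b c d a' b' c' d' : mat2 a b c d * mat2 a' b' c' d' =
  mat2 (a * a' + b * c') (a * b' + b * d') (c * a' + d * c') (c * b' + d * d').
Proof. by rewrite [LHS]mat2E -!mulmxE !mxE !big_ord_recl !big_ord0 !mxE /= !addr0. Qed.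

Lemma mat2Z u a b c d : u *: mat2 a b c d = mat2 (u * a) (u * b) (u * c) (u * d).
Proof. by rewrite [LHS]mat2E !mxE. Qed.

Lemma vec2E v : v = vec2 (v 0 0) (v 1 0).
Proof.
apply/colP=> r; rewrite mxE.
by case: r => -[|[|//]] ? /=; congr (v _ _); apply: val_inj.
Qed.

Lemma mat2_vec2 a b c d a' b' :
  mat2 a b c d *m vec2 a' b' = vec2 (a * a' + b * b') (c * a' + d * b').
Proof.
apply/colP=> r; rewrite !mxE !big_ord_recl !big_ord0 !mxE /= addr0.
by case: ifP.
Qed.

Lemma rscale_vec2 a b u : rscale (vec2 a b) u = vec2 (a * u) (b * u).
Proof. by apply/colP=> r; rewrite !mxE; case: ifP. Qed.

Lemma vec2_inj a b a' b' : vec2 a b = vec2 a' b' -> a = a' /\ b = b'.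
Proof. by move=> /colP E; have := E 0; have := E 1; rewrite !mxE /= => -> ->. Qed.

Lemma line_rscale v u u' : u * u' = 1 -> line (rscale v u) = line v.
Proof.
have rA a b : rscale (rscale v a) b = rscale v (a * b).
  by apply/colP=> r; rewrite !mxE mulrA.
move=> uu'; apply/seteqP; split=> w [a _ <-].
  by exists (u * a); rewrite ?rA.
by exists (u' * a); rewrite // rA mulrA uu' mul1r.
Qed.

(** A line depends on a spanning vector only up to an invertible factor on the
    right; the factor u is read off from the first nonzero coordinate. *)
Lemma line_vec2 u a b c d u' : u * u' = 1 -> a * u = c -> b * u = d ->
  line (vec2 c d) = line (vec2 a b).
Proof. by move=> uu' <- <-; rewrite -rscale_vec2 (line_rscale _ _ _ uu'). Qed.

Arguments line_vec2 {u a b c d u'}.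

Lemma mem_line v : line v v.
Proof. by exists 1 => //; apply/colP=> r; rewrite !mxE mulr1. Qed.

Lemma line_vec2_1 a b u : line (vec2 a b) = line (vec2 1 u) -> b = u * a.
Proof.
move=> E; have := mem_line (vec2 a b); rewrite E => -[h _].
by rewrite rscale_vec2 mul1r => /vec2_inj[-> ->].
Qed.

Lemma line_e2 a b : line (vec2 a b) = line (vec2 0 1) -> a = 0.
Proof.
move=> E; have := mem_line (vec2 a b); rewrite E => -[h _].
by rewrite rscale_vec2 mul0r => /vec2_inj[<- _].
Qed.

Lemma act_line_vec2 a b c d a' b' : act_line (mat2 a b c d) (line (vec2 a' b')) =
  line (vec2 (a * a' + b * b') (c * a' + d * b')).
Proof. by rewrite act_line_line mat2_vec2. Qed.

Lemma act_lineM g h L : act_line (g * h) L = act_line g (act_line h L).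
Proof.
rewrite /act_line image_comp; apply: eq_imagel => x _.
by rewrite -mulmxE /= mulmxA.
Qed.

Lemma act_line1 L : act_line (1 : 'M[H]_2) L = L.
Proof.
rewrite /act_line -[RHS]image_id; apply: eq_imagel => x _.
by rewrite mul1mx.
Qed.

Lemma act_pairM g h p : act_pair (g * h) p = act_pair g (act_pair h p).
Proof.
rewrite /act_pair image_comp; apply: eq_imagel => x _.
by rewrite /= act_lineM.
Qed.

Lemma act_pair1 p : act_pair (1 : 'M[H]_2) p = p.
Proof.
rewrite /act_pair -[RHS]image_id; apply: eq_imagel => x _.
by rewrite act_line1.
Qed.

Lemma act_pair2 g L M : act_pair g [set L; M] = [set act_line g L; act_line g M].
Proof. by rewrite /act_pair image_setU !image_set1. Qed.

(** The square root enters the computations only through this equation, which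
    linear arithmetic can use as it stands. *)
Lemma isqrt2E : exists2 s : R, isqrt2 R = qreal s & s * s * 2 = 1.
Proof.
exists (Num.sqrt 2)^-1 => //.
by rewrite -invfM -expr2 sqr_sqrtr ?mulVf ?pnatr_eq0 ?ler0n.
Qed.

Lemma pm_pairE u : pm_pair u = [set line (vec2 1 u); line (vec2 1 (- u))].
Proof.
have E w : line (isqrt2 R *: vec2 1 w) = line (vec2 1 w).
  have -> : isqrt2 R *: vec2 1 w = rscale (vec2 1 w) (isqrt2 R).
    apply/colP=> r; rewrite !mxE; case: ifP => _; first by rewrite mulr1 mul1r.
    by apply: quat_eqP => /=; ring.
  apply: (@line_rscale _ _ (qreal (Num.sqrt 2))).
  have s0 : Num.sqrt 2 != 0 :> R by rewrite sqrtr_eq0 -ltNge.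
  by apply: quat_eqP => /=; field.
by rewrite /pm_pair !E.
Qed.

Lemma pm_pairN u : pm_pair (- u) = pm_pair u.
Proof. by rewrite !pm_pairE opprK setUC. Qed.

(** * Isometries that permute the pairs *)

Definition qnorm2 u : R := qre u ^+ 2 + qim u ^+ 2 + qjm u ^+ 2 + qkm u ^+ 2.
Definition vnorm2 v : R := qnorm2 (v 0 0) + qnorm2 (v 1 0).

Definition isometry g := forall v, vnorm2 (g *m v) = vnorm2 v.

(** Equality of the image with the whole set, rather than inclusion, makes the
    condition pass to the inverse without counting the pairs. *)
Definition MUB_symmetry : set 'M[H]_2 := [set g |
  [/\ exists h, g * h = 1 /\ h * g = 1, isometry g
    & act_pair g @` MUB_pairs R = MUB_pairs R]].

Lemma MUB_symmetry_subgroup : unit_subgroup MUB_symmetry.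
Proof.
have pM g h A : act_pair (g * h) @` A = act_pair g @` (act_pair h @` A).
  by rewrite image_comp; apply: eq_imagel => p _; rewrite act_pairM.
have p1 A : act_pair (1 : 'M[H]_2) @` A = A.
  by rewrite -[RHS]image_id; apply: eq_imagel => p _; rewrite act_pair1.
split=> [|g h [[g' [gg' g'g]] Ng Pg] [[h' [hh' h'h]] Nh Ph]
        |g [[h [gh hg]] Ng Pg]].
- by split; [exists 1; rewrite mulr1|move=> v; rewrite mul1mx|].
- split; last by rewrite pM Ph.
    by exists (h' * g'); rewrite -!mulrA (mulrA h) (mulrA g') hh' g'g !mul1r.
  by move=> v; rewrite -mulmxE -mulmxA Ng Nh.
- exists h => //; split; first by exists g.
    by move=> v; rewrite -Ng mulmxA mulmxE gh mul1mx.
  by rewrite -[in LHS]Pg -pM hg.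
Qed.
Lemma vnorm2_vec2 a b : vnorm2 (vec2 a b) = qnorm2 a + qnorm2 b.
Proof. by rewrite /vnorm2 !mxE. Qed.

Lemma isometryP g : (forall a b, vnorm2 (g *m vec2 a b) = qnorm2 a + qnorm2 b) ->
  isometry g.
Proof. by move=> Ng v; rewrite [v]vec2E Ng vnorm2_vec2. Qed.

Lemma diagK a b : a * b = 1 -> mat2 a 0 0 1 * mat2 b 0 0 1 = 1.
Proof.
by move=> ab; rewrite mat2M ab mat2_1 !(mulr0, mul0r, mulr1, addr0, add0r).
Qed.

Lemma diag_inv a b : a * b = 1 -> b * a = 1 ->
  exists h, mat2 a 0 0 1 * h = 1 /\ h * mat2 a 0 0 1 = 1.
Proof. by move=> ab ba; exists (mat2 b 0 0 1); rewrite !diagK. Qed.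

Lemma hadamardK : hadamard R * hadamard R = 1.
Proof.
have [s sE s2] := isqrt2E; rewrite /hadamard mat2Z mat2M mat2_1 sE.
by congr mat2; apply: quat_eqP => /=; lra.
Qed.

Lemma qnorm2M a b : qnorm2 (a * b) = qnorm2 a * qnorm2 b.
Proof. by rewrite /qnorm2 /=; ring. Qed.

Lemma diag_isometry a : qnorm2 a = 1 -> isometry (mat2 a 0 0 1).
Proof.
move=> Na; apply: isometryP => x y; rewrite mat2_vec2 vnorm2_vec2.
by rewrite !(mul0r, mul1r, addr0, add0r) qnorm2M Na mul1r.
Qed.

Lemma hadamard_isometry : isometry (hadamard R).
Proof.
apply: isometryP => -[a1 a2 a3 a4] [b1 b2 b3 b4].
have [s sE s2] := isqrt2E.
rewrite /hadamard mat2Z mat2_vec2 vnorm2_vec2 /qnorm2 sE /=.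
by rewrite -[RHS]mul1r -[X in _ = X * _]s2; ring.
Qed.

Lemma MUB_pairs_image g p0 p1 pi pj pk :
  act_pair g (@std_pair R) = p0 -> act_pair g (pm_pair 1) = p1 ->
  act_pair g (pm_pair qi) = pi -> act_pair g (pm_pair qj) = pj ->
  act_pair g (pm_pair qk) = pk ->
  act_pair g @` MUB_pairs R = [set p0; p1; pi; pj; pk].
Proof. by move=> <- <- <- <- <-; apply: image_set5. Qed.

Lemma diag_std_pair a d a' d' : a * a' = 1 -> d * d' = 1 ->
  act_pair (mat2 a 0 0 d) (@std_pair R) = @std_pair R.
Proof.
move=> aa' dd'; rewrite act_pair2 !act_line_vec2 !(mulr0, mul0r, addr0, add0r).
congr [set _; _]; first by apply: (line_vec2 aa'); rewrite ?mul1r ?mul0r ?mulr1.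
by apply: (line_vec2 dd'); rewrite ?mul1r ?mul0r ?mulr1.
Qed.

Lemma diag_pm_pair a d a' u w : a * a' = 1 -> d * u = w * a ->
  act_pair (mat2 a 0 0 d) (pm_pair u) = pm_pair w.
Proof.
move=> aa' E; rewrite !pm_pairE act_pair2 !act_line_vec2.
rewrite !(mulr1, mulr0, mul0r, addr0, add0r).
by congr [set _; _]; apply: (line_vec2 aa'); rewrite ?mul1r ?mulrN ?mulNr ?E.
Qed.

Lemma diag_i_MUB : act_pair (diag_i R) @` MUB_pairs R = MUB_pairs R.
Proof.
have iK : qi * (- qi) = 1 :> H by apply: quat_eqP => /=; ring.
have E u w : u = w * qi -> act_pair (diag_i R) (pm_pair u) = pm_pair w.
  by move=> E; apply: (diag_pm_pair _ _ _ _ _ iK); rewrite mul1r.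
have E1 : act_pair (diag_i R) (pm_pair 1) = pm_pair qi.
  by rewrite -(pm_pairN qi); apply: E; apply: quat_eqP => /=; ring.
have Ei : act_pair (diag_i R) (pm_pair qi) = pm_pair 1.
  by apply: E; apply: quat_eqP => /=; ring.
have Ej : act_pair (diag_i R) (pm_pair qj) = pm_pair qk.
  by apply: E; apply: quat_eqP => /=; ring.
have Ek : act_pair (diag_i R) (pm_pair qk) = pm_pair qj.
  by rewrite -(pm_pairN qj); apply: E; apply: quat_eqP => /=; ring.
have E0 := diag_std_pair _ _ _ _ iK (mulr1 1).
rewrite (MUB_pairs_image _ _ _ _ _ _ E0 E1 Ei Ej Ek); exact: set5_perm2345.
Qed.

Lemma diag_j_MUB : act_pair (diag_j R) @` MUB_pairs R = MUB_pairs R.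
Proof.
have jK : qj * (- qj) = 1 :> H by apply: quat_eqP => /=; ring.
have E u w : u = w * qj -> act_pair (diag_j R) (pm_pair u) = pm_pair w.
  by move=> E; apply: (diag_pm_pair _ _ _ _ _ jK); rewrite mul1r.
have E1 : act_pair (diag_j R) (pm_pair 1) = pm_pair qj.
  by rewrite -(pm_pairN qj); apply: E; apply: quat_eqP => /=; ring.
have Ei : act_pair (diag_j R) (pm_pair qi) = pm_pair qk.
  by rewrite -(pm_pairN qk); apply: E; apply: quat_eqP => /=; ring.
have Ej : act_pair (diag_j R) (pm_pair qj) = pm_pair 1.
  by apply: E; apply: quat_eqP => /=; ring.
have Ek : act_pair (diag_j R) (pm_pair qk) = pm_pair qi.
  by apply: E; apply: quat_eqP => /=; ring.
have E0 := diag_std_pair _ _ _ _ jK (mulr1 1).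
rewrite (MUB_pairs_image _ _ _ _ _ _ E0 E1 Ei Ej Ek); exact: set5_perm2435.
Qed.

Lemma isqrt2K : exists t, isqrt2 R * t = 1.
Proof.
have [s sE s2] := isqrt2E; exists (qreal (2 * s)).
by rewrite sE; apply: quat_eqP => /=; lra.
Qed.

(** The image of (1, u) is (1 + u, 1 - u) up to a real factor, and
    1 - u = - u (1 + u) because u^2 = -1: the slope u becomes - u. *)
Lemma hadamard_pm_pair u : u * u = - 1 ->
  act_pair (hadamard R) (pm_pair u) = pm_pair u.
Proof.
move=> u2; have [s sE s2] := isqrt2E.
have L w : w * w = -1 -> isqrt2 R * w = w * isqrt2 R ->
    act_line (hadamard R) (line (vec2 1 w)) = line (vec2 1 (- w)).
  move=> w2 sw; rewrite act_line_line /hadamard mat2Z mat2_vec2.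
  (* 1 - w inverts 1 + w up to the factor 1 - w^2 = 2 *)
  apply: (@line_vec2 (isqrt2 R * (1 + w)) _ _ _ _ ((1 - w) * isqrt2 R)).
  - have -> : isqrt2 R * (1 + w) * ((1 - w) * isqrt2 R) =
        isqrt2 R * ((1 + w) * (1 - w)) * isqrt2 R by rewrite !mulrA.
    have -> : (1 + w) * (1 - w) = 2.
      by rewrite mulrDl mul1r mulrBr mulr1 w2 opprK addrA subrK.
    by rewrite sE; apply: quat_eqP => /=; lra.
  - by rewrite mul1r !mulr1 mulrDr mulr1.
  - rewrite -!mulrA -mulrDr mulr1 mulrA mulNr -sw -mulrN -mulrA; congr (_ * _).
    by rewrite mulrDr mulr1 mulNr w2 opprK mulN1r addrC.
have su w : isqrt2 R * w = w * isqrt2 R.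
  by rewrite sE; apply: quat_eqP => /=; ring.
by rewrite !pm_pairE act_pair2 !L ?mulrNN // opprK setUC.
Qed.

Lemma hadamard_MUB : act_pair (hadamard R) @` MUB_pairs R = MUB_pairs R.
Proof.
have [i2 j2 k2 _] := quat_relations R.
have E0 : act_pair (hadamard R) (@std_pair R) = pm_pair 1.
  have [t st] := isqrt2K.
  rewrite pm_pairE act_pair2 /hadamard mat2Z !act_line_vec2.
  by congr [set _; _]; apply: (line_vec2 st);
    rewrite !(mulr0, add0r, addr0, mul1r, mulr1, mulN1r, mulrN1).
have E1 : act_pair (hadamard R) (pm_pair 1) = @std_pair R.
  by rewrite -E0 -act_pairM hadamardK act_pair1.
have [Ei Ej Ek] := And3 (hadamard_pm_pair _ i2) (hadamard_pm_pair _ j2)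
  (hadamard_pm_pair _ k2).
rewrite (MUB_pairs_image _ _ _ _ _ _ E0 E1 Ei Ej Ek).
exact: set5_perm12.
Qed.

Lemma P3_gen_inv g : [set diag_i R; diag_j R; hadamard R] g ->
  exists h, g * h = 1 /\ h * g = 1.
Proof.
have [i2 j2 _ _] := quat_relations R.
move=> [[->|->]|->].
- by apply: (diag_inv _ (- qi)); rewrite ?mulrN ?mulNr i2 opprK.
- by apply: (diag_inv _ (- qj)); rewrite ?mulrN ?mulNr j2 opprK.
by exists (hadamard R); rewrite hadamardK.
Qed.

Lemma P3_symmetry : P3 R `<=` MUB_symmetry.
Proof.
apply: gen_group_min; first exact: MUB_symmetry_subgroup.
move=> g Sg; split; first exact: P3_gen_inv.
  case: Sg => [[->|->]|->]; last exact: hadamard_isometry.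
    by apply: diag_isometry; rewrite /qnorm2 /=; ring.
  by apply: diag_isometry; rewrite /qnorm2 /=; ring.
case: Sg => [[->|->]|->]; [exact: diag_i_MUB|exact: diag_j_MUB|].
exact: hadamard_MUB.
Qed.

Lemma MUB_symmetry_lines g : MUB_symmetry g ->
  act_line g @` MUB_lines R = MUB_lines R.
Proof.
move=> [_ _ Pg]; rewrite /MUB_lines image_bigcup -[in RHS]Pg bigcup_image.
by apply: eq_bigcupr.
Qed.

Lemma MUB_symmetry_pairs g : MUB_symmetry g ->
  set_bij (MUB_pairs R) (MUB_pairs R) (act_pair g).
Proof.
move=> [[h [_ hg]] _ Pg]; split.
- by move=> p Pp; rewrite -Pg; exists p.
- by move=> p q _ _ /(congr1 (act_pair h)); rewrite -!act_pairM hg !act_pair1.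
- by move=> p; rewrite -[X in X p -> _]Pg.
Qed.

(** * Elements and subgroups of P3 *)

Lemma P3M g h : P3 R g -> P3 R h -> P3 R (g * h).
Proof. exact: gen_groupM. Qed.

Lemma P3_diag_i : P3 R (diag_i R).
Proof. by apply: sub_gen_group; left; left. Qed.

Lemma P3_diag_j : P3 R (diag_j R).
Proof. by apply: sub_gen_group; left; right. Qed.

Lemma P3_hadamard : P3 R (hadamard R).
Proof. by apply: sub_gen_group; right. Qed.

(** The columns of the Hadamard matrix are eigenvectors of the circulant matrix
    on the right, with eigenvalues u and 1.  The case u = j is [mat_j] and the
    case u = -1 gives the coordinate swap up to sign. *)
Lemma hadamard_conj_diag u : hadamard R * mat2 u 0 0 1 * hadamard R =
  qhalf R *: mat2 (1 + u) (- 1 + u) (- 1 + u) (1 + u).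
Proof.
have [s sE s2] := isqrt2E; case: u => x y z t.
have h1 : 2^-1 = s * s by apply: (@mulIf _ 2); rewrite ?pnatr_eq0 // mulVf ?s2 ?pnatr_eq0.
rewrite /qhalf h1 /hadamard !mat2Z !mat2M sE.
by congr mat2; apply: quat_eqP => /=; ring.
Qed.

Lemma P3_conj_diag u : P3 R (mat2 u 0 0 1) ->
  P3 R (qhalf R *: mat2 (1 + u) (- 1 + u) (- 1 + u) (1 + u)).
Proof.
move=> Pu; rewrite -hadamard_conj_diag; apply: P3M; last exact: P3_hadamard.
by apply: P3M => //; exact: P3_hadamard.
Qed.

Lemma P2_sub_P3 : P2 R `<=` P3 R.
Proof.
apply: gen_group_mono; first exact: P3_gen_inv.
move=> g [[->|->]|->]; [exact: P3_diag_i|exact: P3_diag_j|].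
by apply: P3_conj_diag; exact: P3_diag_j.
Qed.

Lemma P1_sub_P3 : P1 R `<=` P3 R.
Proof.
apply: gen_group_mono; first exact: P3_gen_inv.
move=> g [->|->]; first exact: P3_diag_i.
by apply: P2_sub_P3; apply: sub_gen_group; right.
Qed.

Lemma P3_diagM a b : P3 R (mat2 a 0 0 1) -> P3 R (mat2 b 0 0 1) ->
  P3 R (mat2 (a * b) 0 0 1).
Proof.
move=> Pa Pb; have := P3M _ _ Pa Pb; rewrite mat2M.
by rewrite !(mul0r, mulr0, addr0, add0r, mulr1).
Qed.

Lemma P3_diagN1 : P3 R (mat2 (- 1) 0 0 1).
Proof.
have [i2 _ _ _] := quat_relations R.
by rewrite -i2; apply: P3_diagM; exact: P3_diag_i.
Qed.

Lemma P3_diagN a : P3 R (mat2 a 0 0 1) -> P3 R (mat2 (- a) 0 0 1).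
Proof. by move=> Pa; rewrite -mulN1r; apply: P3_diagM => //; exact: P3_diagN1. Qed.

Lemma P3_diag_k : P3 R (mat2 qk 0 0 1).
Proof.
have <- : qi * qj = qk :> H by apply: quat_eqP => /=; ring.
by apply: P3_diagM; [exact: P3_diag_i|exact: P3_diag_j].
Qed.

Lemma P3_Nswap : P3 R (mat2 0 (- 1) (- 1) 0).
Proof.
have -> : mat2 0 (- 1) (- 1) 0 =
    qhalf R *: mat2 (1 + - 1) (- 1 + - 1) (- 1 + - 1) (1 + - 1).
  by rewrite mat2Z; congr mat2; apply: quat_eqP => /=; lra.
by apply: P3_conj_diag; exact: P3_diagN1.
Qed.

(** The product of diag(-1, 1) and the negated swap is a quarter turn,
    whose square is -1. *)
Lemma P3_N1 : P3 R (- 1).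
Proof.
have P := P3M _ _ P3_diagN1 P3_Nswap.
suff -> : - 1 = mat2 (- 1) 0 0 1 * mat2 0 (- 1) (- 1) 0 *
                (mat2 (- 1) 0 0 1 * mat2 0 (- 1) (- 1) 0) :> 'M[H]_2 by apply: P3M.
by rewrite mat2_N1 !mat2M; congr mat2; apply: quat_eqP => /=; ring.
Qed.

Lemma P3_swap : P3 R (mat2 0 1 1 0).
Proof.
have -> : mat2 0 1 1 0 = - 1 * mat2 0 (- 1) (- 1) 0 :> 'M[H]_2.
  by rewrite mat2_N1 mat2M; congr mat2; apply: quat_eqP => /=; ring.
by apply: P3M; [exact: P3_N1|exact: P3_Nswap].
Qed.

Lemma P3_twisted_swap u : P3 R (mat2 u 0 0 1) -> P3 R (mat2 0 u (- u) 0).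
Proof.
move=> Pu.
have -> : mat2 0 u (- u) 0 = mat2 u 0 0 1 * mat2 0 1 1 0 * mat2 (- u) 0 0 1.
  by rewrite !mat2M !(mul0r, mulr0, addr0, add0r, mulr1, mul1r).
by apply: P3M; [apply: P3M => //; exact: P3_swap|exact: P3_diagN].
Qed.

Lemma K_sub_P3 : K R `<=` P3 R.
Proof.
apply: gen_group_mono; first exact: P3_gen_inv.
move=> g [[[->|->]|->]|->]; first exact: P3_swap.
- by apply: P3_twisted_swap; exact: P3_diag_i.
- by apply: P3_twisted_swap; exact: P3_diag_j.
- by apply: P3_twisted_swap; exact: P3_diag_k.
Qed.

(** * The group K fixes every pair *)

Lemma antidiag_std_pair b c : b * c = 1 -> c * b = 1 ->
  act_pair (mat2 0 b c 0) (@std_pair R) = @std_pair R.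
Proof.
move=> bc cb; rewrite act_pair2 !act_line_vec2 !(mulr0, mul0r, addr0, add0r).
rewrite [RHS]setUC; congr [set _; _].
  by apply: (line_vec2 cb); rewrite ?mul1r ?mul0r ?mulr1.
by apply: (line_vec2 bc); rewrite ?mul1r ?mul0r ?mulr1.
Qed.

(** The slope u goes to c (b u)^-1, so the hypothesis says that this is u
    or - u. *)
Lemma antidiag_pm_pair b c u u' : b * c = 1 -> u * u' = 1 ->
  u * (b * u) = c \/ u * (b * u) = - c ->
  act_pair (mat2 0 b c 0) (pm_pair u) = pm_pair u.
Proof.
move=> bc uu' ubu; have bu : b * u * (u' * c) = 1.
  by rewrite mulrA -(mulrA b) uu' mulr1.
have bNu : - (b * u) * - (u' * c) = 1 by rewrite mulrNN.
rewrite !pm_pairE act_pair2 !act_line_vec2.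
rewrite !(mulr1, mul0r, addr0, add0r) mulrN.
case: ubu => E; [|rewrite [RHS]setUC]; congr [set _; _].
- by apply: (line_vec2 bu); rewrite ?mul1r.
- by apply: (line_vec2 bNu); rewrite ?mul1r // mulrNN.
- by apply: (line_vec2 bu); rewrite ?mul1r // mulNr E opprK.
- by apply: (line_vec2 bNu); rewrite ?mul1r // mulrN E opprK.
Qed.

(** Invertibility is part of the definition because it is what makes the set a
    group in the sense of [unit_subgroup]. *)
Definition fixes_pairs : set 'M[H]_2 := [set g |
  (exists h, g * h = 1 /\ h * g = 1) /\
  forall p, MUB_pairs R p -> act_pair g p = p].

Lemma fixes_pairs_subgroup : unit_subgroup fixes_pairs.
Proof.
split=> [|g h [[g' [gg' g'g]] Fg] [[h' [hh' h'h]] Fh]|g [[h [gh hg]] Fg]].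
- by split; [exists 1; rewrite mulr1|move=> p _; exact: act_pair1].
- split; last by move=> p Pp; rewrite act_pairM Fh // Fg.
  by exists (h' * g'); rewrite -!mulrA (mulrA h) (mulrA g') hh' g'g !mul1r.
- exists h => //; split; first by exists g.
  by move=> p Pp; rewrite -[in LHS](Fg p Pp) -act_pairM hg act_pair1.
Qed.

Lemma antidiag_fixes_pairs b c : b * c = 1 -> c * b = 1 ->
  (forall u, u = 1 \/ u = qi \/ u = qj \/ u = qk ->
     u * (b * u) = c \/ u * (b * u) = - c) ->
  fixes_pairs (mat2 0 b c 0).
Proof.
move=> bc cb E; split.
  exists (mat2 0 b c 0); rewrite mat2M bc cb mat2_1.
  by rewrite !(mulr0, mul0r, addr0, add0r).
move=> p [[[[->|->]|->]|->]|->]; first exact: antidiag_std_pair.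
- by apply: (antidiag_pm_pair _ _ _ 1 bc); [rewrite mulr1|apply: E; tauto].
- apply: (antidiag_pm_pair _ _ _ (- qi) bc); last by apply: E; tauto.
  by apply: quat_eqP => /=; ring.
- apply: (antidiag_pm_pair _ _ _ (- qj) bc); last by apply: E; tauto.
  by apply: quat_eqP => /=; ring.
- apply: (antidiag_pm_pair _ _ _ (- qk) bc); last by apply: E; tauto.
  by apply: quat_eqP => /=; ring.
Qed.

Lemma K_fixes_pairs : K R `<=` fixes_pairs.
Proof.
apply: gen_group_min; first exact: fixes_pairs_subgroup.
move=> g [[[->|->]|->]|->]; apply: antidiag_fixes_pairs;
  try by apply: quat_eqP => /=; ring.
all: move=> u [->|[->|[->|->]]].
all: first [by left; apply: quat_eqP => /=; ring
           |by right; apply: quat_eqP => /=; ring].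
Qed.

(** * Elements of K *)

Lemma KM g h : K R g -> K R h -> K R (g * h).
Proof. exact: gen_groupM. Qed.

Lemma K_swap : K R (mat2 0 1 1 0).
Proof. by apply: sub_gen_group; left; left; left. Qed.

Lemma K_diagM a b a' b' : K R (mat2 a 0 0 b) -> K R (mat2 a' 0 0 b') ->
  K R (mat2 (a * a') 0 0 (b * b')).
Proof.
move=> Ka Kb; have := KM _ _ Ka Kb; rewrite mat2M.
by rewrite !(mul0r, mulr0, addr0, add0r).
Qed.

Lemma K_diag_signed u : K R (mat2 0 u (- u) 0) -> K R (mat2 u 0 0 (- u)).
Proof.
move=> Ku; have := KM _ _ Ku K_swap.
by rewrite mat2M !(mul0r, mulr0, mulr1, addr0, add0r).
Qed.

Lemma K_diag_i : K R (mat2 qi 0 0 (- qi)).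
Proof. by apply: K_diag_signed; apply: sub_gen_group; left; left; right. Qed.

Lemma K_diag_j : K R (mat2 qj 0 0 (- qj)).
Proof. by apply: K_diag_signed; apply: sub_gen_group; left; right. Qed.

Lemma K_diag_k : K R (mat2 qk 0 0 (- qk)).
Proof. by apply: K_diag_signed; apply: sub_gen_group; right. Qed.

Lemma K_N1 : K R (mat2 (- 1) 0 0 (- 1)).
Proof.
have := K_diagM _ _ _ _ K_diag_i K_diag_i.
by have [i2 _ _ _] := quat_relations R; rewrite mulrNN i2.
Qed.

(** The product diag(i, -i) diag(j, -j) diag(k, -k) is diag(-1, 1), because
    i j k = -1; its negative is diag(1, -1). *)
Lemma K_sign : K R (mat2 1 0 0 (- 1)).
Proof.
have Kij := K_diagM _ _ _ _ K_diag_i K_diag_j.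
have := K_diagM _ _ _ _ (K_diagM _ _ _ _ Kij K_diag_k) K_N1.
have [_ _ _ ijk] := quat_relations R.
by rewrite !(mulrN, mulNr) !mulr1 !opprK ijk opprK.
Qed.

Lemma K_signE a d : d = a \/ d = - a -> K R (mat2 a 0 0 (- a)) ->
  K R (mat2 a 0 0 d).
Proof.
move=> [->|-> //] Ka; have := K_diagM _ _ _ _ Ka K_sign.
by rewrite mulr1 mulrN1 opprK.
Qed.

Lemma K_oppr a : K R (mat2 a 0 0 (- a)) -> K R (mat2 (- a) 0 0 (- - a)).
Proof. by move=> Ka; have := K_diagM _ _ _ _ K_N1 Ka; rewrite !mulN1r. Qed.

(** * Unit quaternions that commute with i and j up to sign *)

Lemma commute_qi a : a * qi = qi * a -> qjm a = 0 /\ qkm a = 0.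
Proof.
by case: a => x y z t E; have /= := congr1 (@qjm R) E; have /= := congr1 (@qkm R) E;
  split; lra.
Qed.

Lemma anticommute_qi a : a * qi = - (qi * a) -> qre a = 0 /\ qim a = 0.
Proof.
by case: a => x y z t E; have /= := congr1 (@qre R) E; have /= := congr1 (@qim R) E;
  split; lra.
Qed.

Lemma commute_qj a : a * qj = qj * a -> qim a = 0 /\ qkm a = 0.
Proof.
by case: a => x y z t E; have /= := congr1 (@qim R) E; have /= := congr1 (@qkm R) E;
  split; lra.
Qed.

Lemma anticommute_qj a : a * qj = - (qj * a) -> qre a = 0 /\ qjm a = 0.
Proof.
by case: a => x y z t E; have /= := congr1 (@qre R) E; have /= := congr1 (@qjm R) E;
  split; lra.
Qed.

Lemma unit_coordinate (x y z t : R) : x ^+ 2 + y ^+ 2 + z ^+ 2 + t ^+ 2 = 1 ->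
  y = 0 -> z = 0 -> t = 0 -> x = 1 \/ x = - 1.
Proof.
move=> E y0 z0 t0; move: E; rewrite y0 z0 t0 expr0n /= !addr0 => /eqP.
by rewrite sqrf_eq1 => /orP[/eqP|/eqP]; [left|right].
Qed.

Lemma unit_commuting_qi_qj a : qnorm2 a = 1 -> a * qi = qi * a ->
  a * qj = qj * a -> a = 1 \/ a = - 1.
Proof.
move=> Na /commute_qi[zz t0] /commute_qj[y0 _].
case: (unit_coordinate _ _ _ _ Na y0 zz t0) => x1; [left|right].
  by apply: quat_eqP; rewrite /= ?x1 ?y0 ?zz ?t0.
by apply: quat_eqP; rewrite /= ?x1 ?y0 ?zz ?t0 ?oppr0.
Qed.

Definition pm_commute a u := a * u = u * a \/ a * u = - (u * a).

(** Commuting with i kills the j and k coordinates and anticommuting with i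
    kills the other two; the same for j with the roles of i and j exchanged.
    One coordinate survives, and the norm makes it 1 or -1. *)
Lemma unit_pm_commute_Q8 a : qnorm2 a = 1 -> pm_commute a qi -> pm_commute a qj ->
  exists2 q, q = 1 \/ q = qi \/ q = qj \/ q = qk & a = q \/ a = - q.
Proof.
rewrite /qnorm2 => Na [/commute_qi[z0 t0]|/anticommute_qi[x0 y0]].
- move=> [/commute_qj[y0 _]|/anticommute_qj[x0 _]].
  + exists 1; first tauto.
    by case: (unit_coordinate _ _ _ _ Na y0 z0 t0) => x1; [left|right];
      apply: quat_eqP; rewrite /= ?x1 ?y0 ?z0 ?t0 ?oppr0.
  + exists qi; first tauto.
    rewrite [X in X + _ + _]addrC in Na.
    by case: (unit_coordinate _ _ _ _ Na x0 z0 t0) => y1; [left|right];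
      apply: quat_eqP; rewrite /= ?x0 ?y1 ?z0 ?t0 ?oppr0.
- move=> [/commute_qj[_ t0]|/anticommute_qj[_ z0]].
  + exists qj; first tauto.
    rewrite [X in X + _]addrC addrA in Na.
    by case: (unit_coordinate _ _ _ _ Na x0 y0 t0) => z1; [left|right];
      apply: quat_eqP; rewrite /= ?x0 ?y0 ?z1 ?t0 ?oppr0.
  + exists qk; first tauto.
    rewrite addrC !addrA in Na.
    by case: (unit_coordinate _ _ _ _ Na x0 y0 z0) => t1; [left|right];
      apply: quat_eqP; rewrite /= ?x0 ?y0 ?z0 ?t1 ?oppr0.
Qed.

(** * The two kernels *)

Lemma isometry_diag_norm a d : isometry (mat2 a 0 0 d) -> qnorm2 a = 1.
Proof.
move=> /(_ (vec2 1 0)); rewrite mat2_vec2 !vnorm2_vec2.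
rewrite !(mulr1, mulr0, mul0r, addr0) /qnorm2 /=.
by rewrite !expr0n expr1n /= !addr0.
Qed.

Lemma std_lines_neq : line (vec2 1 0) <> line (vec2 0 1) :> set 'cV[H]_2.
Proof. by move=> /line_e2/eqP; rewrite oner_eq0. Qed.

(** The two columns span the two standard lines, in either order. *)
Lemma fixes_std_pair g : act_pair g (@std_pair R) = @std_pair R ->
  exists a d, g = mat2 a 0 0 d \/ g = mat2 0 a d 0.
Proof.
rewrite [g]mat2E act_pair2 !act_line_vec2 !(mulr1, mulr0, add0r, addr0).
move=> /(set2_eq _ _ _ _ _ std_lines_neq)[] [].
  move=> /line_vec2_1 -> /line_e2 ->.
  by rewrite mul0r; do 2 eexists; left.
move=> /line_e2 -> /line_vec2_1 ->.
by rewrite mul0r; do 2 eexists; right.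
Qed.

Lemma fixes_line_diag a d u :
  act_line (mat2 a 0 0 d) (line (vec2 1 u)) = line (vec2 1 u) -> d * u = u * a.
Proof.
by rewrite act_line_vec2 !(mulr1, mul0r, add0r, addr0) => /line_vec2_1.
Qed.

Lemma fixes_pm_pair_diag a d u :
  act_pair (mat2 a 0 0 d) (pm_pair u) = pm_pair u ->
  d * u = u * a \/ d * u = - (u * a).
Proof.
rewrite !pm_pairE => E.
have : [set line (vec2 1 u); line (vec2 1 (- u))]
         (act_line (mat2 a 0 0 d) (line (vec2 1 u))).
  by rewrite -E act_pair2; left.
rewrite act_line_vec2 !(mulr1, mul0r, add0r, addr0).
by move=> [/line_vec2_1|/line_vec2_1]; rewrite ?mulNr; [left|right].
Qed.

Lemma kernel_diag_in_K a d : isometry (mat2 a 0 0 d) ->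
  fixes_pairs (mat2 a 0 0 d) -> K R (mat2 a 0 0 d).
Proof.
move=> /isometry_diag_norm Na [_ F].
have E u : MUB_pairs R (pm_pair u) -> d * u = u * a \/ d * u = - (u * a).
  by move=> /F; exact: fixes_pm_pair_diag.
(* the slope u = 1 *)
have da : d = a \/ d = - a.
  by have := E 1; rewrite mulr1 mul1r; apply; do 3 left; right.
have pmE u : MUB_pairs R (pm_pair u) -> pm_commute a u.
  move=> /E; rewrite /pm_commute; case: da => -> //.
  by rewrite mulNr => -[<-|/oppr_inj <-]; rewrite ?opprK; [right|left].
have ci : pm_commute a qi by apply: pmE; left; left; right.
have cj : pm_commute a qj by apply: pmE; left; right.
apply: K_signE da _.
have [q q8 aq] := unit_pm_commute_Q8 _ Na ci cj.
have Kq : K R (mat2 q 0 0 (- q)).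
  case: q8 => [->|[->|[->|->]]]; [exact: K_sign|exact: K_diag_i|exact: K_diag_j|].
  exact: K_diag_k.
by case: aq => ->; [|apply: K_oppr].
Qed.

Lemma swap_sq : mat2 0 1 1 0 * mat2 0 1 1 0 = 1 :> 'M[H]_2.
Proof. by rewrite mat2M mat2_1 !(mul0r, mulr0, mulr1, add0r, addr0). Qed.

Lemma kernel_pairs : act_kernel (@act_pair R) (P3 R) (MUB_pairs R) = K R.
Proof.
apply/seteqP; split=> g; last first.
  by move=> Kg; split; [exact: K_sub_P3|have [] := K_fixes_pairs _ Kg].
move=> [P3g Fg].
have diagP a d : P3 R (mat2 a 0 0 d) -> fixes_pairs (mat2 a 0 0 d) ->
    K R (mat2 a 0 0 d).
  by move=> /P3_symmetry[_ Ng _]; exact: kernel_diag_in_K.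
have FG : fixes_pairs g by split=> //; have [] := P3_symmetry _ P3g.
have [|a [d [gE|gE]]] := fixes_std_pair g; first by apply: Fg; do 4 left.
  by rewrite gE; apply: diagP; rewrite -gE.
(* the antidiagonal case: the swap turns g into a diagonal matrix *)
have swg : mat2 0 1 1 0 * g = mat2 d 0 0 a.
  by rewrite gE mat2M !(mul0r, mulr0, mul1r, add0r, addr0).
have [_ FM _] := fixes_pairs_subgroup.
rewrite -[g]mul1r -swap_sq -mulrA; apply: KM; first exact: K_swap.
rewrite swg; apply: diagP; rewrite -swg.
  by apply: P3M => //; exact: P3_swap.
by apply: FM => //; apply: K_fixes_pairs; exact: K_swap.
Qed.

Lemma MUB_pm_line u : MUB_pairs R (pm_pair u) -> MUB_lines R (line (vec2 1 u)).
Proof. by move=> Pu; exists (pm_pair u) => //; rewrite pm_pairE; left. Qed.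

Lemma MUB_lines_line L : MUB_lines R L -> exists v, L = line v.
Proof.
by move=> [_ [[[[->|->]|->]|->]|->]] [->|->]; eexists.
Qed.

Lemma act_lineN1 v : act_line (- 1) (line v) = line v.
Proof.
rewrite act_line_line mulNmx mul1mx.
have -> : - v = rscale v (- 1) by apply/colP=> r; rewrite !mxE mulrN1.
by apply: (line_rscale _ _ (- 1)); rewrite mulrNN mulr1.
Qed.

Lemma kernel_lines : act_kernel (@act_line R) (P3 R) (MUB_lines R) = [set 1; - 1].
Proof.
apply/seteqP; split=> g; last first.
  move=> [->|->]; last first.
    by split; [exact: P3_N1|move=> L /MUB_lines_line[v ->]; exact: act_lineN1].
  split; last by move=> L _; exact: act_line1.
  by have [] := gen_group_subgroup P3_gen_inv.
move=> [/P3_symmetry[_ Ng _] Fg].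
have L0 : MUB_lines R (line (vec2 1 0)).
  by exists (@std_pair R); [do 4 left|left].
have L1 : MUB_lines R (line (vec2 0 1)).
  by exists (@std_pair R); [do 4 left|right].
have gE : g = mat2 (g 0 0) 0 0 (g 1 1).
  have := Fg _ L0; have := Fg _ L1; rewrite {1 2}[g]mat2E !act_line_vec2.
  rewrite !(mulr1, mulr0, add0r, addr0) => /line_e2 g01 /line_vec2_1.
  by rewrite mul0r => g10; rewrite [LHS]mat2E g01 g10.
have E u : MUB_pairs R (pm_pair u) -> g 1 1 * u = u * g 0 0.
  by move=> /MUB_pm_line /Fg; rewrite gE => /fixes_line_diag; rewrite !mxE.
have da : g 1 1 = g 0 0.
  by have := E 1; rewrite mulr1 mul1r; apply; do 3 left; right.
have Ei : g 0 0 * qi = qi * g 0 0 by rewrite -{1}da; apply: E; left; left; right.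
have Ej : g 0 0 * qj = qj * g 0 0 by rewrite -{1}da; apply: E; left; right.
have N0 : qnorm2 (g 0 0) = 1 by move: Ng; rewrite {1}gE => /isometry_diag_norm.
rewrite gE da.
case: (unit_commuting_qi_qj _ N0 Ei Ej) => ->; [left|right].
  by rewrite mat2_1.
by rewrite mat2_N1.
Qed.

End QuatPlane.

Theorem mainTheorem2 (R : realType) :
  [/\ (forall g : 'M[quat R]_2, P1 R g -> act_line g @` MUB_lines R = MUB_lines R),
      (forall g : 'M[quat R]_2, P2 R g -> act_line g @` MUB_lines R = MUB_lines R)
    & (forall g : 'M[quat R]_2, P3 R g -> act_line g @` MUB_lines R = MUB_lines R)] /\
  (act_kernel (@act_line R) (P3 R) (MUB_lines R) = gen_group [set - 1] /\
   gen_group [set - 1] = [set 1; - 1] :> set 'M[quat R]_2) /\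
  (forall g : 'M[quat R]_2, P3 R g ->
     set_bij (MUB_pairs R) (MUB_pairs R) (act_pair g)) /\
  act_kernel (@act_pair R) (P3 R) (MUB_pairs R) = K R.
Proof.
have P3L g : P3 R g -> act_line g @` MUB_lines R = MUB_lines R.
  by move=> /P3_symmetry; exact: MUB_symmetry_lines.
split; first by split=> g; [move/P1_sub_P3/P3L|move/P2_sub_P3/P3L|exact: P3L].
split; first by rewrite gen_groupN1 kernel_lines.
split; last exact: kernel_pairs.
by move=> g /P3_symmetry; exact: MUB_symmetry_pairs.
Qed.
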